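(* Let $\mathcal L^{(3)}\subseteq\mathcal L\times\mathcal L\times\mathcal L$ denote the set of all triples of pairwise opposite Lagrangians of $M$. Then there is a $\mathbf U(M)$-invariant surjective map $$\kappa:\mathcal L^{(3)}\longrightarrow \mathrm{Herm}_\varepsilon^\circ(n)$$ whose fibers are precisely the $\mathbf U(M)$-orbits in $\mathcal L^{(3)}$. The map $\kappa$ is given by $$\kappa(g(X),g(Y),gu_t(Y))=\langle t\rangle ,$$ where $g\in\mathbf U(M)$, $t$ is a nonsingular $\varepsilon$-hermitian $n\times n$ matrix, and $(X,Y)$ is the fixed pair of opposite Lagrangians.
   Context: $D$ is a field or division ring of arbitrary characteristic with an involution $J$ (an antiautomorphism with $J^2=\mathrm{id}$; $J=\mathrm{id}$ is allowed if $D$ is commutative), and $\varepsilon\in\{1,-1\}$. Modules are finite dimensional right $D$-modules. For a matrix $a$ over $D$, $a^J$ denotes the transpose of $a$ with $J$ applied to all entries, and $a^{-J}=(a^J)^{-1}$. For $\delta=\pm1$, a $\delta$-hermitian form on $M$ is a biadditive map $h:M\times M\to D$ with $h(ua,vb)=a^Jh(u,v)b$ and $h(u,v)=h(v,u)^J\delta$. For a right $D$-module $X$, $X^J$ is its dual space made into a right $D$-module by $(\xi a)(v)=a^J\xi(v)$. The hyperbolic $\delta$-hermitian module on $X$ is $X\oplus X^J$ with the form $h_X((x,\xi),(y,\eta))=\xi(y)+\eta(x)^J\delta$; every isometric module is also called hyperbolic, and its rank is $\dim X$. Throughout, $M$ is a $-\varepsilon$-hermitian hyperbolic module of rank $n$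 with form $h$, and $\mathbf U(M)$ is its group of isometries. A Lagrangian is a subspace $X\subseteq M$ with $X=X^\perp$; $\mathcal L$ is the set of Lagrangians. Two Lagrangians $X,Y$ are opposite if $X\cap Y=0$ (equivalently $M=X+Y$). Fix an $n$-dimensional module $X$ with basis $\mathbf x$, let $Y=X^J$ with the dual basis $\mathbf y$, and take $M=X\oplus Y$ with basis $\mathbf x,\mathbf y$ and form $h=h_X$, represented by the block matrix $\begin{pmatrix}0&-\varepsilon\\1&0\end{pmatrix}$. Let $H=\{t\in D^{n\times n}\mid t-t^J\varepsilon=0\}$ be the set of $\varepsilon$-hermitian matrices, and for $t\in H$ let $u_t=\begin{pmatrix}1&t\\0&1\end{pmatrix}\in\mathbf U(M)$. The group $\mathbf{GL}_nD$ acts on $H$ by $(a,t)\mapsto a^{-J}ta^{-1}$; the orbit of $t$ is denoted $\langle t\rangle$, and $\mathrm{Herm}_\varepsilon^\circ(n)$ is the set of orbits $\langle t\rangle$ of nonsingular $t\in H$ (the isomorphism classes of nondegenerate $\varepsilon$-hermitian forms on $D^n$). *)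

(* Defs.v *)
From HB Require Import structures.
From mathcomp Require Import all_boot all_algebra.
From mathcomp Require Import boolp classical_sets functions.
Set Implicit Arguments.
Unset Strict Implicit.
Unset Printing Implicit Defensive.
Import GRing.Theory.
Local Open Scope classical_set_scope.
Local Open Scope ring_scope.

(* A division ring is a D : unitRingType satisfying GRing.field_axiom D, and a
   right D-module is a left module over the converse ring, V : lmodType D^c. *)

Definition rscale (D : nzRingType) (V : lmodType D^c) (v : V) (a : D) : V :=
  (a : D^c) *: v.

Notation "v *> a" := (rscale v a) (at level 40, left associativity) : ring_scope.

Record involution (D : nzRingType) := Involution {
  involution_fun :> D -> D;
  involutionD : {morph involution_fun : a b / a + b};
  involutionM : forall a b,
    involution_fun (a * b) = involution_fun b * involution_fun a;
  involutionK : involutive involution_fun }.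

Lemma involution1 (D : nzRingType) (J : involution D) : J 1 = 1.
Proof.
by have := involutionM J (J 1) 1; rewrite mulr1 involutionK mulr1.
Qed.

(* J is a parameter because the scalar action depends on it. *)
Record dual (D : nzRingType) (X : lmodType D^c) (J : involution D) := Dual {
  dual_fun :> X -> D;
  dualD : {morph dual_fun : u v / u + v};
  dualZ : forall v a, dual_fun (v *> a) = dual_fun v * a }.

Section Dual.
Variables (D : nzRingType) (X : lmodType D^c) (J : involution D).

HB.instance Definition _ := gen_eqMixin (dual X J).
HB.instance Definition _ := gen_choiceMixin (dual X J).

Lemma dualP (xi eta : dual X J) : (forall v, xi v = eta v) -> xi = eta.
Proof.
case: xi eta => [f fD fZ] [g gD gZ] /= /funext e.
by case: g / e gD gZ => gD gZ; congr Dual; apply: Prop_irrelevance.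
Qed.

Program Definition dual_zero : dual X J := @Dual D X J (fun=> 0) _ _.
Next Obligation. by move=> u v; rewrite addr0. Qed.
Next Obligation. by rewrite mul0r. Qed.

Program Definition dual_opp (xi : dual X J) : dual X J :=
  @Dual D X J (fun v => - xi v) _ _.
Next Obligation. by move=> u v; rewrite dualD opprD. Qed.
Next Obligation. by rewrite dualZ mulNr. Qed.

Program Definition dual_add (xi eta : dual X J) : dual X J :=
  @Dual D X J (fun v => xi v + eta v) _ _.
Next Obligation. by move=> u v; rewrite !dualD addrACA. Qed.
Next Obligation. by rewrite !dualZ mulrDl. Qed.

Program Definition dual_scale (a : D^c) (xi : dual X J) : dual X J :=
  @Dual D X J (fun v => J a * xi v) _ _.
Next Obligation. by move=> u v; rewrite dualD mulrDr. Qed.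
Next Obligation. by rewrite dualZ mulrA. Qed.

Lemma dual_addA : associative dual_add.
Proof. by move=> a b c; apply: dualP => v /=; rewrite addrA. Qed.
Lemma dual_addC : commutative dual_add.
Proof. by move=> a b; apply: dualP => v /=; rewrite addrC. Qed.
Lemma dual_add0 : left_id dual_zero dual_add.
Proof. by move=> a; apply: dualP => v /=; rewrite add0r. Qed.
Lemma dual_addN : left_inverse dual_zero dual_opp dual_add.
Proof. by move=> a; apply: dualP => v /=; rewrite addNr. Qed.

HB.instance Definition _ := GRing.isZmodule.Build (dual X J)
  dual_addA dual_addC dual_add0 dual_addN.

Lemma dual_scaleA a b xi : dual_scale a (dual_scale b xi) = dual_scale (a * b) xi.
Proof. by apply: dualP => v /=; rewrite involutionM mulrA. Qed.
Lemma dual_scale1 : left_id 1 dual_scale.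
Proof. by move=> xi; apply: dualP => v /=; rewrite involution1 mul1r. Qed.
Lemma dual_scaleDr : right_distributive dual_scale +%R.
Proof. by move=> a xi eta; apply: dualP => v /=; rewrite mulrDr. Qed.
Lemma dual_scaleDl xi : {morph dual_scale^~ xi : a b / a + b}.
Proof. by move=> a b; apply: dualP => v /=; rewrite involutionD mulrDl. Qed.

HB.instance Definition _ := GRing.Zmodule_isLmodule.Build D^c (dual X J)
  dual_scaleA dual_scale1 dual_scaleDr dual_scaleDl.

Definition hyp_module : lmodType D^c := (X * dual X J)%type.

Definition hyp_form (delta : D) (u v : hyp_module) : D :=
  u.2 v.1 + J (v.2 u.1) * delta.

End Dual.

Section Bases.
Variables (D : nzRingType) (V : lmodType D^c) (m : nat) (b : 'I_m -> V).

Definition lincomb (c : 'cV[D]_m) : V := \sum_(i < m) b i *> c i 0.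

Definition is_basis : Prop :=
  (forall v, exists c, v = lincomb c) /\ (forall c, lincomb c = 0 -> c = 0).

(* Meaningful when b is a basis, in which case it is the only such c. *)
Definition coordinates (v : V) : 'cV[D]_m :=
  xget 0 [set c : 'cV[D]_m | v = lincomb c].

(* The endomorphism represented by A with respect to the basis b; the j-th
   column of A holds the coordinates of the image of b j. *)
Definition mx_end (A : 'M[D]_m) (v : V) : V := lincomb (A *m coordinates v).

End Bases.

Definition hyp_basis (D : nzRingType) (J : involution D) (X : lmodType D^c)
    (n : nat) (x : 'I_n -> X) (y : 'I_n -> dual X J) (k : 'I_(n + n)) :
    hyp_module X J :=
  match fintype.split k with inl i => (x i, 0) | inr j => (0, y j) end.

Definition u_mx (D : nzRingType) (n : nat) (t : 'M[D]_n) : 'M[D]_(n + n) :=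
  block_mx 1%:M t 0 1%:M.

Section Lagrangians.
Variables (D : nzRingType) (M : lmodType D^c) (h : M -> M -> D).

Definition isometries : set {linear M -> M} :=
  [set g : {linear M -> M} | bijective g /\ forall u v, h (g u) (g v) = h u v].

Definition is_subspace (L : set M) : Prop :=
  [/\ L 0, forall u v, L u -> L v -> L (u + v)
    & forall v a, L v -> L (v *> a)].

Definition perp (L : set M) : set M :=
  [set v | forall u, L u -> h u v = 0].

Definition is_lagrangian (L : set M) : Prop :=
  is_subspace L /\ L = perp L.

Definition opposite (L L' : set M) : Prop := L `&` L' = [set 0].

Definition triples : set (set M * set M * set M) :=
  [set T | [/\ is_lagrangian T.1.1, is_lagrangian T.1.2 & is_lagrangian T.2]
        /\ [/\ opposite T.1.1 T.1.2, opposite T.1.1 T.2 & opposite T.1.2 T.2]].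

Definition triple_act (g : M -> M) (T : set M * set M * set M) :=
  (g @` T.1.1, g @` T.1.2, g @` T.2).

Definition triple_orbit (T : set M * set M * set M) :=
  [set triple_act g T | g in isometries].

End Lagrangians.

Section Hermitian.
Variables (D : nzRingType) (J : involution D) (eps : D) (n : nat).

Definition mxJ (p q : nat) (a : 'M[D]_(p, q)) : 'M[D]_(q, p) := map_mx J a^T.

(* The library's unitmx and invmx require a commutative ring. *)
Definition mx_inverse (a b : 'M[D]_n) : Prop :=
  a *m b = 1%:M /\ b *m a = 1%:M.

Definition nonsingular (a : 'M[D]_n) : Prop := exists b, mx_inverse a b.

Definition herm_mx : set 'M[D]_n := [set t | t - mxJ t *m eps%:M = 0].

(* In the action t |-> a^-J t a^-1, b stands for a^-1 and c for a^-J. *)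
Definition herm_orbit (t : 'M[D]_n) : set 'M[D]_n :=
  [set s | exists a b c : 'M[D]_n,
     [/\ mx_inverse a b, mx_inverse (mxJ a) c & s = c *m t *m b]].

Definition Herm : set (set 'M[D]_n) :=
  [set herm_orbit t | t in [set t | herm_mx t /\ nonsingular t]].

End Hermitian.

Arguments Herm {D} J eps n.

(* Main.v *)
From HB Require Import structures.
Require Import Defs.
From mathcomp Require Import all_boot all_algebra.
From mathcomp Require Import boolp classical_sets functions.
Import GRing.Theory.
Set Implicit Arguments.
Unset Strict Implicit.
Local Open Scope classical_set_scope.
Local Open Scope ring_scope.

(** Over a commutative field the theorem would be an exercise in block matrices;
    the same block matrices work here once the few facts of linear algebra that
    need division are available for noncommutative coefficients.  They all come
    from [wide_mx_kernel]: a matrix with more columns than rows kills a nonzero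
    column.  It gives bases of subspaces, and turns injective square matrices
    into invertible ones.

    In the basis [hyp_basis x y] the form has Gram matrix
    S = (0, -eps; 1, 0), isometries are the matrices G with G^J S G = S, and a
    Lagrangian is the column span of a matrix A with A^J S A = 0 that is maximal
    for this.  If the spans of A and B are opposite Lagrangians, the pairing
    B^J S A is injective, and (A B) is injective together with the matrix of its
    pairing with all of M; comparing sizes, A and B have n columns and B^J S A is
    invertible.  After a change of basis in the second span the pairing of A with
    B becomes -eps, and then (A B) is itself an isometry.  Hence U(M) is
    transitive on pairs of opposite Lagrangians
    ([opposite_lagrangians_standard]), and a triple may be moved so that it
    starts with (X, Y).

    A third Lagrangian opposite to X projects isomorphically to Y, so it is the
    graph u_t(Y) of some matrix t; being isotropic says that t is
    eps-hermitian, being opposite to Y that t is nonsingular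
    ([opposite_standard_graph]).  The isometries that stabilize X and Y are the
    matrices diag(d^-J, d), and such a matrix maps the graph of t to the graph of
    d^-J t d^-1, which is the action of GL_n on hermitian matrices
    ([standard_triple_orbit]).  So the orbits of triples correspond to the
    classes of t.  Accordingly kappa T is taken to be the set of all s such that
    T is a translate of (X, Y, u_s(Y)): no choice is involved, invariance and
    the description of the fibers are visible, and the two lemmas above say that
    this set is a single class of nonsingular hermitian matrices. *)

(** * Linear algebra over a division ring *)

Section InjectiveMatrices.
Variable D : nzRingType.

Definition injective_mx (m p : nat) (A : 'M[D]_(m, p)) : Prop :=
  forall c : 'cV_p, A *m c = 0 -> c = 0.

Lemma injective_mx_eq (m p q : nat) (A : 'M[D]_(m, p)) (B C : 'M_(p, q)) :
  injective_mx A -> A *m B = A *m C -> B = C.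
Proof.
move=> injA e; apply/eqP; rewrite -subr_eq0; apply/eqP/matrixP => i j.
have /injA/colP/(_ i) : A *m col j (B - C) = 0.
  by rewrite colE mulmxA mulmxBr e subrr mul0mx.
by rewrite !mxE.
Qed.

Lemma left_inverse_injective (m p : nat) (A : 'M[D]_(m, p)) (B : 'M_(p, m)) :
  B *m A = 1%:M -> injective_mx A.
Proof. by move=> BA c Ac; rewrite -[c]mul1mx -BA -mulmxA Ac mulmx0. Qed.

Lemma mx_factor_cols (m p q : nat) (A : 'M[D]_(m, p)) (B : 'M_(m, q)) :
  (forall j, exists c : 'cV_q, col j A = B *m c) -> exists P, A = B *m P.
Proof.
move=> /choice[f fP]; exists (\matrix_(i, j) f j i 0); apply/matrixP => i j.
have /colP/(_ i) := fP j; rewrite [LHS]mxE => ->.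
by rewrite !mxE; apply: eq_bigr => k _; rewrite mxE.
Qed.

End InjectiveMatrices.

Section DivisionRing.
Variables (D : unitRingType) (hD : GRing.field_axiom D).

(** Elimination of one unknown: if some A 0 j is nonzero, the first equation
    gives c j in terms of the other unknowns, and substituting it into the
    remaining equations leaves m equations in p unknowns.  Scalars of a solution
    stand on the right of the coefficients, so the pivot is inverted on the left
    of its row. *)
Lemma wide_mx_kernel (m p : nat) (A : 'M[D]_(m, p)) :
  (m < p)%N -> exists2 c : 'cV_p, c != 0 & A *m c = 0.
Proof.
elim: m p A => [|m IHm] [|p] A //.
  move=> _; exists (const_mx 1); last by apply/colP => -[].
  by apply/eqP => /matrixP/(_ 0 0); rewrite !mxE; apply/eqP/oner_neq0.
rewrite ltnS => lt_mp.
have [/forallP A0|] := boolP [forall k, A 0 k == 0].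
  have [c c0 Ac] := IHm p.+1 (row' 0 A) (ltnW lt_mp).
  exists c => //; apply/colP => i; rewrite !mxE.
  have [k ->|->] := unliftP 0 i.
    have /colP/(_ k) := Ac; rewrite !mxE => e; rewrite -[RHS]e.
    by apply: eq_bigr => l _; rewrite !mxE.
  by rewrite big1 // => k _; rewrite (eqP (A0 k)) mul0r.
rewrite negb_forall => /existsP[j Aj].
have [c c0 Ac] := IHm p (\matrix_(i, k) (A (lift 0 i) (lift j k)
  - A (lift 0 i) j * (A 0 j)^-1 * A 0 (lift j k))) lt_mp.
pose s := \sum_k A 0 (lift j k) * c k 0.
exists (\col_k if unlift j k is Some k' then c k' 0 else - (A 0 j)^-1 * s).
  apply: contraNneq c0 => c'0; apply/eqP/colP => k.
  by have /colP/(_ (lift j k)) := c'0; rewrite !mxE liftK.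
apply/colP => i; rewrite !mxE (bigD1_ord j) //= mxE unlift_none.
under eq_bigr do rewrite mxE liftK.
have [k ->|->] := unliftP 0 i; last first.
  by rewrite mulNr mulrN mulrA divrr ?hD // mul1r addNr.
have /colP/(_ k) := Ac; rewrite !mxE => e; rewrite -[RHS]e.
under [in RHS]eq_bigr do rewrite mxE mulrBl -!mulrA.
by rewrite big_split /= sumrN -!mulr_sumr addrC mulNr mulrN.
Qed.

Lemma injective_mx_leq (m p : nat) (A : 'M[D]_(m, p)) : injective_mx A -> (p <= m)%N.
Proof.
move=> injA; rewrite leqNgt; apply/negP => /(wide_mx_kernel A)[c c0 /injA c1].
by rewrite c1 eqxx in c0.
Qed.

(** A relation A c + v d = 0 other than the trivial one has d nonzero, because A
    is injective; dividing by d on the right expresses v. *)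
Lemma injective_row_mx_adjoin (m p : nat) (A : 'M[D]_(m, p)) (v : 'cV_m) :
  injective_mx A -> ~ injective_mx (row_mx A v) -> exists c, v = A *m c.
Proof.
move=> injA ninj; apply: contrapT => nv; apply: ninj => c.
rewrite -[c]vsubmxK mul_row_col; set c1 := usubmx c; set d := dsubmx c.
have [->|d0] := eqVneq d 0; first by rewrite mulmx0 addr0 => /injA ->; rewrite col_mx0.
move=> e; case: nv; exists (- c1 *m (d 0 0)^-1%:M).
have ud : d 0 0 \is a GRing.unit.
  apply: hD; apply: contraNneq d0 => d0; apply/eqP/colP => i.
  by rewrite ord1 d0 mxE.
have dE : d = (d 0 0)%:M by apply: mx11_scalar.
rewrite mulmxA mulmxN; have -> : - (A *m c1) = v *m d.
  by apply/eqP; rewrite eq_sym -addr_eq0 addrC e.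
by rewrite {1}dE -mulmxA -scalar_mxM divrr // mulmx1.
Qed.

(** Adjoining any column to A gives a matrix too wide to be injective, so A is
    surjective, and a right inverse of an injective matrix is two-sided. *)
Lemma injective_mx_inverse (m : nat) (A : 'M[D]_m) :
  injective_mx A -> exists B, mx_inverse A B.
Proof.
move=> injA.
have surjA (v : 'cV_m) : exists c, v = A *m c.
  apply: injective_row_mx_adjoin => // /injective_mx_leq.
  by rewrite addn1 ltnn.
have [B AB] := mx_factor_cols (A := 1%:M) (fun j => surjA (col j _)).
exists B; split=> //; apply: (injective_mx_eq injA).
by rewrite mulmxA -AB mul1mx mulmx1.
Qed.

Lemma left_inverse_mx_inverse (m : nat) (A B : 'M[D]_m) :
  B *m A = 1%:M -> mx_inverse A B.
Proof.
move=> BA; have [C [AC _]] := injective_mx_inverse (left_inverse_injective BA).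
by split=> //; rewrite -[B]mulmx1 -AC (mulmxA B) BA mul1mx.
Qed.

(** A is an injective matrix with columns in L and as many of them as possible;
    the number is bounded by [injective_mx_leq]. *)
Lemma subspace_mx_basis (m : nat) (L : set 'cV[D]_m) :
  L 0 -> (forall u v, L u -> L v -> L (u + v)) ->
  (forall v a, L v -> L (v *m a%:M)) ->
  exists (p : nat) (A : 'M[D]_(m, p)),
    injective_mx A /\ L = [set A *m c | c in setT].
Proof.
move=> L0 LD LZ.
pose P p := `[< exists A : 'M[D]_(m, p), injective_mx A /\ forall c, L (A *m c) >].
have P0 : exists p, P p.
  exists 0%N; apply/asboolP; exists 0; split=> [c _|c]; last by rewrite mul0mx.
  by rewrite [c]flatmx0.
have Pm p : P p -> (p <= m)%N by move/asboolP=> [A [/injective_mx_leq]].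
case: (ex_maxnP P0 Pm) => p /asboolP[A [injA LA]] pmax.
exists p, A; split=> //; apply/seteqP; split=> [v Lv|_ [c _ <-]] //.
suff [c ->] : exists c, v = A *m c by exists c.
apply: injective_row_mx_adjoin => // injAv.
have /pmax : P (p + 1)%N.
  apply/asboolP; exists (row_mx A v); split=> // c.
  rewrite -[c]vsubmxK mul_row_col; apply: LD => //.
  by rewrite [dsubmx c]mx11_scalar; apply: LZ.
by rewrite addn1 ltnn.
Qed.

End DivisionRing.

(** * Conjugate transposition *)

Section ConjugateTranspose.
Variables (D : nzRingType) (J : involution D).

Lemma involution0 : J 0 = 0.
Proof. by apply: (addIr (J 0)); rewrite -involutionD !add0r. Qed.

Lemma involutionN a : J (- a) = - J a.
Proof. by apply: (addIr (J a)); rewrite -involutionD !addNr involution0. Qed.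

Lemma involution_sum (I : Type) (r : seq I) (P : pred I) (F : I -> D) :
  J (\sum_(i <- r | P i) F i) = \sum_(i <- r | P i) J (F i).
Proof. exact: (big_morph J (involutionD J) involution0). Qed.

Lemma mxJ_mul (m p q : nat) (A : 'M[D]_(m, p)) (B : 'M_(p, q)) :
  mxJ J (A *m B) = mxJ J B *m mxJ J A.
Proof.
apply/matrixP => i j; rewrite !mxE involution_sum; apply: eq_bigr => k _.
by rewrite !mxE involutionM.
Qed.

Lemma mxJK (m p : nat) : cancel (@mxJ D J m p) (@mxJ D J p m).
Proof. by move=> A; apply/matrixP => i j; rewrite !mxE involutionK. Qed.

Lemma mxJ1 (m : nat) : mxJ J (1%:M : 'M_m) = 1%:M.
Proof.
apply/matrixP => i j; rewrite !mxE eq_sym.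
by case: eqP; rewrite ?involution1 ?involution0.
Qed.

Lemma mxJ0 (m p : nat) : mxJ J (0 : 'M_(m, p)) = 0.
Proof. by apply/matrixP => i j; rewrite !mxE involution0. Qed.

Lemma mxJN (p q : nat) (A : 'M[D]_(p, q)) : mxJ J (- A) = - mxJ J A.
Proof. by apply/matrixP => i j; rewrite !mxE involutionN. Qed.

Lemma mxJ_col_mx (m p q : nat) (A : 'M[D]_(m, q)) (B : 'M_(p, q)) :
  mxJ J (col_mx A B) = row_mx (mxJ J A) (mxJ J B).
Proof. by rewrite /mxJ tr_col_mx map_row_mx. Qed.

Lemma mxJ_row_mx (m p q : nat) (A : 'M[D]_(q, m)) (B : 'M_(q, p)) :
  mxJ J (row_mx A B) = col_mx (mxJ J A) (mxJ J B).
Proof. by rewrite /mxJ tr_row_mx map_col_mx. Qed.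

Lemma mxJ_block_mx (m p q r : nat) (A : 'M[D]_(m, p)) (B : 'M_(m, q))
    (C : 'M_(r, p)) (E : 'M_(r, q)) :
  mxJ J (block_mx A B C E) = block_mx (mxJ J A) (mxJ J C) (mxJ J B) (mxJ J E).
Proof. by rewrite /mxJ tr_block_mx map_block_mx. Qed.

Lemma mxJ_delta (m p : nat) i j :
  mxJ J (delta_mx i j) = delta_mx j i :> 'M[D]_(m, p).
Proof.
apply/matrixP => k l; rewrite !mxE andbC.
by case: (_ && _); rewrite ?involution1 ?involution0.
Qed.

(** Transfers identities between values of the form to identities between Gram
    matrices. *)
Lemma sesquilinear_mx_eq (m p : nat) (P Q : 'M[D]_(m, p)) :
  (forall (c : 'cV_m) (d : 'cV_p),
     (mxJ J c *m P *m d) 0 0 = (mxJ J c *m Q *m d) 0 0 :> D) ->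
  P = Q.
Proof.
move=> PQ; apply/matrixP => i j; have := PQ (delta_mx i 0) (delta_mx j 0).
by rewrite mxJ_delta -!rowE -!colE !mxE.
Qed.

End ConjugateTranspose.

(** * Coordinates *)

Section Coordinates.
Variables (D : nzRingType) (V : lmodType D^c) (m : nat) (b : 'I_m -> V).

Lemma rscale0 (v : V) : v *> (0 : D) = 0.
Proof. exact: scale0r. Qed.

Lemma rscale1 (v : V) : v *> (1 : D) = v.
Proof. exact: scale1r. Qed.

Lemma rscaleDr (v : V) (a c : D) : v *> (a + c) = v *> a + v *> c.
Proof. exact: scalerDl. Qed.

Lemma rscaleA (v : V) (a c : D) : v *> (a * c) = v *> a *> c.
Proof. by rewrite /rscale scalerA. Qed.

Lemma rscale_suml (I : Type) (r : seq I) (P : pred I) (F : I -> V) (a : D) :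
  (\sum_(i <- r | P i) F i) *> a = \sum_(i <- r | P i) F i *> a.
Proof. exact: scaler_sumr. Qed.

Lemma rscale_sumr (I : Type) (r : seq I) (P : pred I) (F : I -> D) (v : V) :
  v *> (\sum_(i <- r | P i) F i) = \sum_(i <- r | P i) v *> F i.
Proof. exact: (scaler_suml v r P F). Qed.

Lemma lincomb0 : lincomb b 0 = 0.
Proof. by rewrite /lincomb big1 // => i _; rewrite mxE rscale0. Qed.

Lemma lincombD c d : lincomb b (c + d) = lincomb b c + lincomb b d.
Proof.
by rewrite /lincomb -big_split; apply: eq_bigr => i _; rewrite mxE rscaleDr.
Qed.

Lemma lincomb_rscale c (a : D) : lincomb b (c *m a%:M) = lincomb b c *> a.
Proof.
rewrite /lincomb rscale_suml; apply: eq_bigr => i _.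
by rewrite mxE big_ord1 mxE mulr1n rscaleA.
Qed.

Lemma lincomb_mulmx (p : nat) (A : 'M[D]_(m, p)) (c : 'cV_p) :
  lincomb b (A *m c) = lincomb (fun j => lincomb b (col j A)) c.
Proof.
rewrite /lincomb; under [RHS]eq_bigr do rewrite rscale_suml.
rewrite exchange_big; apply: eq_bigr => i _; rewrite mxE rscale_sumr.
by apply: eq_bigr => j _; rewrite rscaleA mxE.
Qed.

Lemma lincomb_delta j : lincomb b (delta_mx j 0) = b j.
Proof.
rewrite /lincomb (bigD1 j) //= mxE !eqxx rscale1 big1 ?addr0 // => i ij.
by rewrite mxE (negPf ij) rscale0.
Qed.

Definition mx_span (p : nat) (A : 'M[D]_(m, p)) : set V :=
  [set lincomb b (A *m c) | c in setT].

(** A relation between functions and matrices rather than the function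
    [mx_end b G]: isometries are bundled linear maps, and it applies to
    both. *)
Definition represents (g : V -> V) (G : 'M[D]_m) : Prop :=
  forall c, g (lincomb b c) = lincomb b (G *m c).

Lemma image_mx_span g G (p : nat) (A : 'M[D]_(m, p)) :
  represents g G -> g @` mx_span A = mx_span (G *m A).
Proof.
move=> gG; rewrite /mx_span image_comp; apply: eq_imagel => c _ /=.
by rewrite gG mulmxA.
Qed.

Lemma mx_span_mulr (p q : nat) (A : 'M[D]_(m, p)) (B : 'M_(p, q)) :
  mx_span (A *m B) `<=` mx_span A.
Proof. by move=> _ [c _ <-]; exists (B *m c); rewrite ?mulmxA. Qed.

(** The freedom in the choice of a basis of a fixed subspace. *)
Lemma mx_span_inverse (p : nat) (A : 'M[D]_(m, p)) (B C : 'M_p) :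
  mx_inverse B C -> mx_span (A *m B) = mx_span A.
Proof.
move=> [BC _]; apply/seteqP; split; first exact: mx_span_mulr.
by rewrite -{1}[A]mulmx1 -BC mulmxA; exact: mx_span_mulr.
Qed.

Lemma linear_lincomb (g : {linear V -> V}) c :
  g (lincomb b c) = lincomb (g \o b) c.
Proof. by rewrite /lincomb linear_sum; apply: eq_bigr => i _; exact: linearZ. Qed.

Hypothesis basis_b : is_basis b.

Lemma lincomb_inj : injective (lincomb b).
Proof.
have lincombN c : lincomb b (- c) = - lincomb b c.
  by apply: (addIr (lincomb b c)); rewrite -lincombD !addNr lincomb0.
move=> c d cd; apply/eqP; rewrite -subr_eq0; apply/eqP/basis_b.2.
by rewrite lincombD lincombN cd subrr.
Qed.

Lemma coordinatesK v : lincomb b (coordinates b v) = v.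
Proof.
have [c vc] := basis_b.1 v; rewrite /coordinates.
by case: xgetP => [_ -> <- //|/(_ c)]; case.
Qed.

Lemma lincombK c : coordinates b (lincomb b c) = c.
Proof. by apply: lincomb_inj; rewrite coordinatesK. Qed.

Lemma mx_end_represents (G : 'M[D]_m) : represents (mx_end b G) G.
Proof. by move=> c; rewrite /mx_end lincombK. Qed.

Lemma exists_linear_represents (G : 'M[D]_m) :
  exists g : {linear V -> V}, represents g G.
Proof.
have lin : linear (mx_end b G).
  move=> a u v; rewrite -[u]coordinatesK -[v]coordinatesK.
  rewrite -[a *: _]/(_ *> (a : D)) -lincomb_rscale -lincombD.
  by rewrite !mx_end_represents mulmxDr lincombD mulmxA lincomb_rscale.
pose L := GRing.isLinear.Build _ _ _ _ (mx_end b G) lin.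
pose g : {linear V -> V} := HB.pack (mx_end b G) L.
by exists g; exact: mx_end_represents.
Qed.

Lemma exists_mx_represents (g : {linear V -> V}) : exists G, represents g G.
Proof.
exists (\matrix_(i, j) coordinates b (g (b j)) i 0) => c.
rewrite linear_lincomb lincomb_mulmx; apply: eq_bigr => j _ /=; congr (_ *> _).
rewrite -{1}[g (b j)]coordinatesK; congr lincomb.
by apply/colP => i; rewrite !mxE.
Qed.

Lemma represents_bijective g G E :
  represents g G -> mx_inverse G E -> bijective g.
Proof.
move=> gG [GE EG]; exists (mx_end b E) => v; rewrite -[v]coordinatesK.
  by rewrite gG mx_end_represents mulmxA EG mul1mx.
by rewrite mx_end_represents gG mulmxA GE mul1mx.
Qed.

Lemma mx_span_lincomb (p : nat) (A : 'M[D]_(m, p)) c :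
  mx_span A (lincomb b c) -> exists d, c = A *m d.
Proof. by move=> [d _ /lincomb_inj <-]; exists d. Qed.

Lemma mx_span_subset (p q : nat) (A : 'M[D]_(m, p)) (B : 'M_(m, q)) :
  mx_span A `<=` mx_span B -> exists P, A = B *m P.
Proof.
move=> AB; apply: mx_factor_cols => j; apply: mx_span_lincomb; apply: AB.
by exists (delta_mx j 0); rewrite -?colE.
Qed.

End Coordinates.

Lemma subspace_mx_span (D : unitRingType) (hD : GRing.field_axiom D)
    (V : lmodType D^c) (m : nat) (b : 'I_m -> V) (L : set V) :
  is_basis b -> is_subspace L ->
  exists (p : nat) (A : 'M[D]_(m, p)), injective_mx A /\ L = mx_span b A.
Proof.
move=> basis_b [L0 LD LZ].
have [||| p [A [injA LA]]] := subspace_mx_basis hD (L := [set c | L (lincomb b c)]).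
- by rewrite /= lincomb0.
- by move=> c d /= Lc Ld; rewrite lincombD; apply: LD.
- by move=> c a /= Lc; rewrite lincomb_rscale; apply: LZ.
exists p, A; split=> //; apply/seteqP; split=> [v Lv|_ [c _ <-]].
  have : [set c | L (lincomb b c)] (coordinates b v) by rewrite /= coordinatesK.
  by rewrite LA => -[c _ cv]; exists c; rewrite ?cv ?coordinatesK.
have : [set A *m c | c in setT] (A *m c) by exists c.
by rewrite -LA.
Qed.

(** * Isometries *)

Section Isometries.
Variables (D : nzRingType) (V : lmodType D^c) (h : V -> V -> D).

Lemma isometries_id : isometries h idfun.
Proof. by split=> //; exists id. Qed.

Lemma isometries_comp (g k : {linear V -> V}) :
  isometries h g -> isometries h k -> isometries h (g \o k).
Proof.
move=> [bg hg] [bk hk]; split=> [|u v]; first exact: bij_comp.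
by rewrite /= hg hk.
Qed.

Lemma isometries_inverse (g : {linear V -> V}) : isometries h g ->
  exists2 k : {linear V -> V}, isometries h k & cancel g k /\ cancel k g.
Proof.
move=> [[k gK kK] hg].
pose L := GRing.isLinear.Build _ _ _ _ k (can2_linear gK kK).
pose f : {linear V -> V} := HB.pack k L.
exists f => //; split; first by exists g.
by move=> u v; rewrite -hg /= !kK.
Qed.

Lemma triple_act_comp (g k : V -> V) T :
  triple_act (g \o k) T = triple_act g (triple_act k T).
Proof. by rewrite /triple_act !image_comp. Qed.

Lemma triple_act_cancel (g k : V -> V) T :
  cancel g k -> triple_act k (triple_act g T) = T.
Proof.
move=> gK; rewrite -triple_act_comp (_ : k \o g = id); last exact/funext.
by case: T => [[L L'] L'']; rewrite /triple_act !image_id.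
Qed.

Lemma isometry_lagrangian (g : {linear V -> V}) L :
  isometries h g -> is_lagrangian h L -> is_lagrangian h (g @` L).
Proof.
move=> [[k gK kK] hg] [[L0 LD LZ] LE]; split.
  split; first by exists 0; rewrite ?linear0.
    by move=> _ _ [u Lu <-] [v Lv <-]; exists (u + v); [apply: LD|rewrite linearD].
  by move=> _ a [v Lv <-]; exists (v *> a); [apply: LZ|exact: linearZ].
apply/seteqP; split=> [_ [v Lv <-] _ [u Lu <-]|v pv].
  by rewrite hg; move: Lv; rewrite LE => /(_ u Lu).
exists (k v); rewrite ?kK // LE => u Lu.
by rewrite -hg kK; apply: pv; exists u.
Qed.

Lemma opposite_sym (L L' : set V) : opposite L L' -> opposite L' L.
Proof. by rewrite /opposite setIC. Qed.

Lemma isometry_opposite (g : {linear V -> V}) L L' :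
  isometries h g -> opposite L L' -> opposite (g @` L) (g @` L').
Proof.
move=> [/bij_inj gI _] LL'; apply/seteqP; split=> [_ [[u Lu <-] [v Lv]]|_ ->].
  move=> /gI vu; have : (L `&` L') u by split=> //; rewrite -vu.
  by rewrite LL' => ->; rewrite linear0.
have [L0 L'0] : (L `&` L') 0 by rewrite LL'.
by split; exists 0; rewrite ?linear0.
Qed.

Lemma isometry_triples (g : {linear V -> V}) T :
  isometries h g -> triples h T -> triples h (triple_act g T).
Proof.
by move=> ig [[? ? ?] [? ? ?]]; split; split;
  (exact: isometry_lagrangian || exact: isometry_opposite).
Qed.

End Isometries.

(** * The hyperbolic module in coordinates *)

Section HyperbolicBasis.
Variables (D : nzRingType) (J : involution D) (n : nat) (X : lmodType D^c).
Variables (x : 'I_n -> X) (y : 'I_n -> dual X J).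
Hypotheses (basis_x : is_basis x) (dual_xy : forall i j, y i (x j) = (i == j)%:R).

Lemma dual_sum (xi : dual X J) (I : Type) (r : seq I) (P : pred I) (F : I -> X) :
  xi (\sum_(i <- r | P i) F i) = \sum_(i <- r | P i) xi (F i).
Proof.
have xi0 : xi 0 = 0 by apply: (addIr (xi 0)); rewrite -dualD !add0r.
exact: (big_morph xi (dualD xi) xi0).
Qed.

Lemma sum_dualE (I : Type) (r : seq I) (P : pred I) (F : I -> dual X J) v :
  (\sum_(i <- r | P i) F i) v = \sum_(i <- r | P i) F i v.
Proof. exact: (big_morph (fun xi : dual X J => xi v)). Qed.

Lemma rscale_dualE (xi : dual X J) (a : D) v : (xi *> a) v = J a * xi v.
Proof. by []. Qed.

Lemma lincomb_dualE c d :
  lincomb y d (lincomb x c) = (mxJ J d *m c) 0 0.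
Proof.
rewrite /lincomb sum_dualE mxE; apply: eq_bigr => i _.
rewrite rscale_dualE !mxE dual_sum (bigD1 i) //= dualZ dual_xy eqxx mul1r.
rewrite big1 ?addr0 // => j ji.
by rewrite dualZ dual_xy eq_sym (negPf ji) mul0r.
Qed.

(** The coordinates of xi are J (xi (x i)) and not xi (x i), since scalars act on
    the dual through J. *)
Lemma dual_basis : is_basis y.
Proof.
split=> [xi|d yd].
  exists (\col_i J (xi (x i))); apply: dualP => v.
  have [c ->] := basis_x.1 v; rewrite lincomb_dualE mxE /lincomb dual_sum.
  by apply: eq_bigr => i _; rewrite dualZ !mxE involutionK.
rewrite -[d](mxJK J) (_ : mxJ J d = 0) ?mxJ0 //.
apply/rowP => j; have := lincomb_dualE (delta_mx j 0) d.
by rewrite yd -colE !mxE => <-.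
Qed.

Lemma lincomb_hyp_basis c d :
  lincomb (hyp_basis x y) (col_mx c d) = (lincomb x c, lincomb y d).
Proof.
have pairE (I : Type) (r : seq I) (F : I -> hyp_module X J) :
    \sum_(i <- r) F i = (\sum_(i <- r) (F i).1, \sum_(i <- r) (F i).2).
  by elim/big_rec3: _ => //= i a b v _ ->.
rewrite /lincomb big_split_ord /= !pairE.
congr (_, _) => /=.
  rewrite [X in _ + X]big1 ?addr0 => [|i _].
    by apply: eq_bigr => i _; rewrite col_mxEu /hyp_basis (unsplitK (inl i)).
  by rewrite /hyp_basis (unsplitK (inr i)) /=; exact: scaler0.
rewrite [X in X + _]big1 ?add0r => [|i _].
  by apply: eq_bigr => i _; rewrite col_mxEd /hyp_basis (unsplitK (inr i)).
by rewrite /hyp_basis (unsplitK (inl i)) /=; exact: scaler0.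
Qed.

Lemma hyp_basis_is_basis : is_basis (hyp_basis x y).
Proof.
split=> [[v xi]|c].
  have [[c ->] [d ->]] := (basis_x.1 v, dual_basis.1 xi).
  by exists (col_mx c d); rewrite lincomb_hyp_basis.
rewrite -[c]vsubmxK lincomb_hyp_basis => -[/basis_x.2 -> /dual_basis.2 ->].
exact: col_mx0.
Qed.

Lemma first_summand_span :
  [set v : hyp_module X J | v.2 = 0] = mx_span (hyp_basis x y) (col_mx 1%:M 0).
Proof.
apply/seteqP; split=> [[v xi] /= ->|_ [c _ <-]].
  have [c ->] := basis_x.1 v; exists c => //.
  by rewrite mul_col_mx mul1mx mul0mx lincomb_hyp_basis lincomb0.
by rewrite mul_col_mx mul1mx mul0mx lincomb_hyp_basis /= lincomb0.
Qed.

Lemma second_summand_span :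
  [set v : hyp_module X J | v.1 = 0] = mx_span (hyp_basis x y) (col_mx 0 1%:M).
Proof.
apply/seteqP; split=> [[v xi] /= ->|_ [c _ <-]].
  have [c ->] := dual_basis.1 xi; exists c => //.
  by rewrite mul_col_mx mul1mx mul0mx lincomb_hyp_basis lincomb0.
by rewrite mul_col_mx mul1mx mul0mx lincomb_hyp_basis /= lincomb0.
Qed.

End HyperbolicBasis.

Section HyperbolicGram.
Variables (D : nzRingType) (J : involution D) (eps : D) (n : nat).
Hypothesis heps : eps = 1 \/ eps = -1.
Local Notation E := (eps%:M).
Local Notation "A ^J" := (mxJ J A) (at level 1, format "A ^J").

Lemma scalar_opp1 p : (-1)%:M = - 1%:M :> 'M[D]_p.
Proof. exact: raddfN. Qed.

Lemma eps_mxC (p q : nat) (A : 'M[D]_(p, q)) : E *m A = A *m E.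
Proof.
by case: heps => ->; rewrite ?scalar_opp1 ?mulNmx ?mulmxN mulmx1 mul1mx.
Qed.

Lemma eps_mxK p : E *m E = 1%:M :> 'M[D]_p.
Proof.
by case: heps => ->; rewrite ?scalar_opp1 ?mulNmx ?mulmxN mulmx1 ?opprK.
Qed.

Lemma eps_mxJ p : E^J = E :> 'M[D]_p.
Proof. by case: heps => ->; rewrite ?scalar_opp1 ?mxJN mxJ1. Qed.

Definition hyp_gram : 'M[D]_(n + n) := block_mx 0 (- E) 1%:M 0.
Local Notation S := hyp_gram.

Lemma hyp_gramJ : S^J = - (S *m E).
Proof.
rewrite mxJ_block_mx !mxJ0 mxJ1 mxJN eps_mxJ (scalar_mx_block _ _ eps) mulmx_block.
rewrite !mul0mx !mulmx0 !addr0 !add0r mulNmx eps_mxK mul1mx opp_block_mx.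
by rewrite oppr0 opprK.
Qed.

Lemma hyp_gramJK : S^J *m S = 1%:M.
Proof.
rewrite mxJ_block_mx !mxJ0 mxJ1 mxJN eps_mxJ mulmx_block.
rewrite !mul0mx !mulmx0 !addr0 !add0r mulNmx mulmxN opprK eps_mxK mul1mx.
by rewrite -scalar_mx_block.
Qed.

(** The -eps-hermitian symmetry of the form, for whole families of vectors. *)
Lemma gram_sesquilinear_symm (p q : nat) (A : 'M_(n + n, p)) (B : 'M_(n + n, q)) :
  (A^J *m S *m B)^J = - (B^J *m S *m A *m E).
Proof.
by rewrite !mxJ_mul mxJK hyp_gramJ mulNmx mulmxN -(mulmxA S) eps_mxC !mulmxA.
Qed.

End HyperbolicGram.

(** * Lagrangians of the hyperbolic module *)

Section HyperbolicLagrangians.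
Variables (D : unitRingType) (hD : GRing.field_axiom D) (J : involution D).
Variables (eps : D) (heps : eps = 1 \/ eps = -1) (n : nat) (X : lmodType D^c).
Variables (x : 'I_n -> X) (y : 'I_n -> dual X J).
Hypotheses (basis_x : is_basis x) (dual_xy : forall i j, y i (x j) = (i == j)%:R).

Let M := hyp_module X J.
Let h : M -> M -> D := hyp_form (- eps).
Let b : 'I_(n + n) -> M := hyp_basis x y.
Let basis_b : is_basis b := hyp_basis_is_basis basis_x dual_xy.
Local Notation E := (eps%:M).
Local Notation "A ^J" := (mxJ J A) (at level 1, format "A ^J").
Local Notation S := (hyp_gram eps n).
Local Notation span := (mx_span b).
Local Notation lagrangian := (is_lagrangian h).

Lemma hyp_formE c d : h (lincomb b c) (lincomb b d) = (c^J *m S *m d) 0 0.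
Proof.
rewrite -[c]vsubmxK -[d]vsubmxK; move: (usubmx c) (dsubmx c) (usubmx d) (dsubmx d).
move=> c1 c2 d1 d2; rewrite /h /hyp_form !lincomb_hyp_basis /=.
rewrite !lincomb_dualE // mxJ_col_mx mul_row_block mul_row_col.
rewrite !mulmx0 add0r addr0 mulmx1 [in RHS]mxE; congr (_ + _).
have -> : c1^J *m - E *m d2 = - ((d2^J *m c1)^J *m E).
  by rewrite mxJ_mul mxJK mulmxN mulNmx -mulmxA (eps_mxC heps) mulmxA.
by move: (d2^J *m c1) => Q; rewrite mulrN [in RHS]mxE [in RHS]mxE big_ord1 !mxE mulr1n.
Qed.

Lemma hyp_form_mulmxE (p q : nat) (A : 'M_(n + n, p)) (B : 'M_(n + n, q)) c d :
  h (lincomb b (A *m c)) (lincomb b (B *m d)) = (c^J *m (A^J *m S *m B) *m d) 0 0.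
Proof. by rewrite hyp_formE mxJ_mul !mulmxA. Qed.

Definition isometry_mx (G : 'M[D]_(n + n)) : Prop := G^J *m S *m G = S.

Lemma isometries_isometry_mx (g : {linear M -> M}) G :
  isometries h g -> represents b g G -> isometry_mx G.
Proof.
move=> [_ hg] gG; apply: (@sesquilinear_mx_eq _ J) => c d.
by rewrite -hyp_form_mulmxE -!gG hg hyp_formE.
Qed.

(** S^J S = 1, so G^J S G = S exhibits S^J G^J S as a left inverse of G. *)
Lemma isometry_mx_isometries G : isometry_mx G ->
  exists2 g : {linear M -> M}, isometries h g & represents b g G.
Proof.
move=> GSG; have [g gG] := exists_linear_represents basis_b G; exists g => //.
have [E GE] : exists E, mx_inverse G E.
  exists (S^J *m (G^J *m S)); apply: (left_inverse_mx_inverse hD).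
  by rewrite -mulmxA GSG (hyp_gramJK J n heps).
split=> [|u v]; first exact: (represents_bijective basis_b gG GE).
rewrite -[u](coordinatesK basis_b) -[v](coordinatesK basis_b) !gG.
by rewrite hyp_form_mulmxE GSG hyp_formE.
Qed.

Lemma lagrangian_isotropic (p : nat) (A : 'M_(n + n, p)) :
  lagrangian (span A) -> A^J *m S *m A = 0.
Proof.
move=> [_ AE]; apply: (@sesquilinear_mx_eq _ J) => c d.
rewrite -hyp_form_mulmxE mulmx0 mul0mx mxE.
have : span A (lincomb b (A *m d)) by exists d.
by rewrite {1}AE; apply; exists c.
Qed.

(** The inclusion of L^perp in L, where L^perp is the kernel of A^J S. *)
Lemma lagrangian_maximal (p : nat) (A : 'M_(n + n, p)) (v : 'cV_(n + n)) :
  lagrangian (span A) -> A^J *m S *m v = 0 -> exists c, v = A *m c.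
Proof.
move=> [_ AE] Av; apply: (mx_span_lincomb basis_b); rewrite AE => _ [c _ <-].
by rewrite hyp_formE mxJ_mul -!mulmxA (mulmxA A^J) Av mulmx0 mxE.
Qed.

Lemma opposite_mx (p q : nat) (A : 'M_(n + n, p)) (B : 'M_(n + n, q))
    (c : 'cV_p) (d : 'cV_q) :
  opposite (span A) (span B) -> A *m c = B *m d -> A *m c = 0.
Proof.
move=> AB cd; apply: (lincomb_inj basis_b); rewrite lincomb0.
have : (span A `&` span B) (lincomb b (A *m c)).
  by split; [exists c|exists d; rewrite ?cd].
by rewrite AB.
Qed.

(** A vector of the first subspace that pairs to zero with the second lies in the
    second too, by maximality, hence in the intersection. *)
Lemma opposite_pairing_injective (p q : nat) (A : 'M_(n + n, p)) (B : 'M_(n + n, q)) :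
  injective_mx A -> lagrangian (span B) -> opposite (span A) (span B) ->
  injective_mx (B^J *m S *m A).
Proof.
move=> injA lagB AB c; rewrite -(mulmxA _ A) => /(lagrangian_maximal lagB)[d cd].
exact/injA/(opposite_mx AB cd).
Qed.

(** The pairing is injective from either side, so p = q.  The sum of the two
    subspaces is direct, so p + q <= 2n; a vector orthogonal to both of them lies
    in their intersection, so pairing with p + q vectors detects all of M and
    2n <= p + q. *)
Lemma opposite_lagrangian_dim (p q : nat) (A : 'M_(n + n, p)) (B : 'M_(n + n, q)) :
  injective_mx A -> injective_mx B ->
  lagrangian (span A) -> lagrangian (span B) -> opposite (span A) (span B) ->
  p = n /\ q = n.
Proof.
move=> injA injB lagA lagB AB.
have le_pq := injective_mx_leq hD (opposite_pairing_injective injA lagB AB).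
have le_qp := injective_mx_leq hD
  (opposite_pairing_injective injB lagA (opposite_sym AB)).
have /(injective_mx_leq hD) le_n : injective_mx (row_mx A B).
  move=> c; rewrite -[c]vsubmxK mul_row_col => /eqP; rewrite addr_eq0 -mulmxN => /eqP e.
  have Ac := opposite_mx AB e; rewrite (injA _ Ac).
  move: e; rewrite Ac => /esym/injB/eqP; rewrite oppr_eq0 => /eqP ->.
  exact: col_mx0.
have /(injective_mx_leq hD) ge_n : injective_mx ((row_mx A B)^J *m S).
  move=> v; rewrite mxJ_row_mx !mul_col_mx -col_mx0 => /eq_col_mx[].
  move=> /(lagrangian_maximal lagA)[c ->] /(lagrangian_maximal lagB)[d].
  exact: opposite_mx.
have pq : p = q by apply/eqP; rewrite eqn_leq le_pq.
move: le_n ge_n; rewrite -pq !addnn !leq_double => le_n ge_n.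
by split; apply/eqP; rewrite eqn_leq le_n.
Qed.

Local Notation X0 := [set v : M | v.2 = 0].
Local Notation Y0 := [set v : M | v.1 = 0].

(** Rescaling a basis B of L' by the inverse of its pairing with a basis A of L,
    up to the factor -eps, makes (A B') satisfy the same relations as the
    standard basis, so it is the matrix of an isometry. *)
Lemma opposite_lagrangians_standard (L L' : set M) :
  lagrangian L -> lagrangian L' -> opposite L L' ->
  exists2 g : {linear M -> M}, isometries h g & L = g @` X0 /\ L' = g @` Y0.
Proof.
move=> lagL lagL' LL'.
have [p [A [injA LA]]] := subspace_mx_span hD basis_b lagL.1.
have [q [B [injB LB]]] := subspace_mx_span hD basis_b lagL'.1.
subst L L'; have [pn qn] := opposite_lagrangian_dim injA injB lagL lagL' LL'; subst p q.
have [R [QR RQ]] := injective_mx_inverse hD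
  (opposite_pairing_injective injB lagL (opposite_sym LL')).
(* With this scaling A^J S B' is -E, the upper right block of S. *)
pose B' := B *m (R *m - E).
have RE : mx_inverse (R *m - E) (- E *m (A^J *m S *m B)).
  split; last first.
    by rewrite mulmxA -(mulmxA (- E)) QR mulmx1 mulmxN mulNmx opprK (eps_mxK heps).
  by rewrite mulmxA -(mulmxA R) mulmxN mulNmx opprK (eps_mxK heps) mulmx1 RQ.
have AB' : A^J *m S *m B' = - E by rewrite /B' !mulmxA QR mul1mx.
have B'A : B'^J *m S *m A = 1%:M.
  have e : B'^J *m S *m A *m E = E.
    by apply: oppr_inj; rewrite -gram_sesquilinear_symm // AB' mxJN eps_mxJ.
  by rewrite -[LHS]mulmx1 -(eps_mxK heps n) mulmxA e (eps_mxK heps).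
have B'B' : B'^J *m S *m B' = 0.
  rewrite /B' mxJ_mul mulmxA -!(mulmxA (_ ^J)) 2!(mulmxA B^J).
  by rewrite (lagrangian_isotropic lagL') mul0mx !mulmx0.
have [|g ig gG] := @isometry_mx_isometries (row_mx A B').
  rewrite /isometry_mx mxJ_row_mx mul_col_mx mul_col_row.
  by rewrite AB' B'A B'B' (lagrangian_isotropic lagL).
exists g => //; split.
  rewrite (first_summand_span y basis_x) (image_mx_span _ gG).
  by rewrite mul_row_col mulmx1 mulmx0 addr0.
rewrite (second_summand_span basis_x dual_xy) (image_mx_span _ gG).
by rewrite mul_row_col mulmx1 mulmx0 add0r (mx_span_inverse _ _ RE).
Qed.

Lemma u_mx_image t : mx_end b (u_mx t) @` Y0 = span (col_mx t 1%:M).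
Proof.
rewrite (second_summand_span basis_x dual_xy).
rewrite (image_mx_span _ (mx_end_represents basis_b _)) mul_block_col.
by rewrite !mul1mx mulmx1 mulmx0 !add0r.
Qed.

(** The case s = t shows that the graph of t is isotropic exactly when t is
    hermitian. *)
Lemma graph_isotropicE (t s : 'M[D]_n) :
  (col_mx t 1%:M)^J *m S *m col_mx s 1%:M = s - t^J *m E.
Proof.
rewrite mxJ_col_mx mul_row_block mul_row_col mxJ1 !mulmx0 !mulmx1 add0r addr0.
by rewrite mul1mx mulmxN.
Qed.

(** If C = (C1; C2) spans L, then C2 is injective because L meets X trivially,
    and L is spanned by C C2^-1 = (t; 1) with t = C1 C2^-1. *)
Lemma opposite_standard_graph (L : set M) :
  lagrangian X0 -> lagrangian L -> opposite X0 L -> opposite Y0 L ->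
  exists t, [/\ herm_mx J eps t, nonsingular t & L = mx_end b (u_mx t) @` Y0].
Proof.
rewrite (first_summand_span y basis_x) (second_summand_span basis_x dual_xy).
move=> lagX lagL XL YL.
have [p [C [injC LC]]] := subspace_mx_span hD basis_b lagL.1; subst L.
have injX : injective_mx (col_mx 1%:M 0 : 'M[D]_(n + n, n)).
  apply: (@left_inverse_injective _ _ _ _ (row_mx 1%:M 0)).
  by rewrite mul_row_col mulmx1 mul0mx addr0.
have [_ pn] := opposite_lagrangian_dim injX injC lagX lagL XL; subst p.
have [C2i C2K] : exists C2i, mx_inverse (dsubmx C) C2i.
  apply: (injective_mx_inverse hD) => c C2c; apply: injC.
  apply: (@opposite_mx _ _ _ (col_mx 1%:M 0) c (usubmx C *m c)).
    exact: opposite_sym.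
  by rewrite -{1}[C]vsubmxK !mul_col_mx C2c mul1mx mul0mx.
pose t := usubmx C *m C2i; exists t.
have tE : col_mx t 1%:M = C *m C2i.
  by rewrite -{1}[C]vsubmxK mul_col_mx C2K.1.
have Lt : span C = span (col_mx t 1%:M).
  rewrite tE; apply/esym/mx_span_inverse; split; [exact: C2K.2|exact: C2K.1].
rewrite Lt in lagL YL *; split=> //; last first.
- by rewrite -u_mx_image (second_summand_span basis_x dual_xy).
- apply: (injective_mx_inverse hD) => c tc.
  have /(opposite_mx YL) : col_mx 0 1%:M *m c = col_mx t 1%:M *m c.
    by rewrite !mul_col_mx tc mul0mx.
  by rewrite mul_col_mx mul1mx mul0mx -col_mx0 => /eq_col_mx[].
by have := lagrangian_isotropic lagL; rewrite graph_isotropicE.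
Qed.

Lemma first_summand_lagrangian : lagrangian X0.
Proof.
split; first split=> //=.
- by move=> u v /= u0 v0; rewrite u0 v0 addr0.
- by move=> v a /= ->; exact: scaler0.
apply/seteqP; split=> [v /= v0 u /= u0|[v xi] pv /=].
  by rewrite /h /hyp_form u0 v0 /= involution0 mul0r addr0.
apply: dualP => w; have /= := pv (w, 0) erefl.
rewrite /h /hyp_form /= add0r mulrN => /eqP; rewrite oppr_eq0 => /eqP.
by case: heps => ->; rewrite ?mulrN mulr1 => /(congr1 (fun a => J a));
  rewrite ?involutionN involutionK involution0 // => /eqP; rewrite oppr_eq0 => /eqP.
Qed.

Lemma second_summand_lagrangian : lagrangian Y0.
Proof.
split; first split=> //=.
- by move=> u v /= u0 v0; rewrite u0 v0 addr0.
- by move=> v a /= ->; exact: scaler0.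
have eval0 (xi : dual X J) : xi 0 = 0 by rewrite -(rscale0 (0 : X)) dualZ mulr0.
apply/seteqP; split=> [v /= v0 u /= u0|[v xi] pv /=].
  by rewrite /h /hyp_form u0 v0 !eval0 involution0 mul0r addr0.
have [c vc] := basis_x.1 v; rewrite vc (_ : c = 0) ?lincomb0 //.
apply/colP => i; have /= := pv (0, y i) erefl.
rewrite /h /hyp_form /= eval0 involution0 mul0r addr0 vc -(lincomb_delta y i).
by rewrite lincomb_dualE // mxJ_delta -rowE !mxE.
Qed.

(** * Triples of pairwise opposite Lagrangians *)

Local Notation graph t := (mx_end b (u_mx t) @` Y0).

Definition standard_triple (t : 'M[D]_n) : set M * set M * set M :=
  (X0, Y0, graph t).

Lemma graphP t v : graph t v -> exists c, v = (lincomb x (t *m c), lincomb y c).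
Proof.
rewrite u_mx_image => -[c _ <-]; exists c.
by rewrite mul_col_mx mul1mx lincomb_hyp_basis.
Qed.

(** For hermitian t, u_t is an isometry, and it carries Y to the graph. *)
Lemma lagrangian_graph t : herm_mx J eps t -> lagrangian (graph t).
Proof.
rewrite /herm_mx /= => tH; have [|g ig gG] := @isometry_mx_isometries (u_mx t).
  rewrite /isometry_mx mxJ_block_mx !mxJ1 mxJ0 !mulmx_block.
  rewrite !mul0mx !mulmx0 !mulmx1 !mul1mx !addr0 !add0r mulmxN.
  by rewrite mul0mx mul1mx add0r tH.
have -> : graph t = g @` Y0.
  rewrite (second_summand_span basis_x dual_xy) (image_mx_span _ gG).
  exact/image_mx_span/mx_end_represents.
exact: isometry_lagrangian ig second_summand_lagrangian.
Qed.

Lemma standard_triple_triples t :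
  herm_mx J eps t -> nonsingular t -> triples h (standard_triple t).
Proof.
move=> tH [t' [_ t't]]; have lagG := lagrangian_graph tH.
have X00 : X0 0 by []. have Y00 : Y0 0 by [].
have G0 : graph t 0 by have [[]] := lagG.
have basis_y := dual_basis basis_x dual_xy.
split; split=> //=; [exact: first_summand_lagrangian|exact: second_summand_lagrangian|..];
  apply/seteqP; split=> [v|_ ->] //.
- by case: v => [v xi] [/= -> ->].
- move=> [/= v0 /graphP[c vc]]; move: v0; rewrite vc /= => /basis_y.2 ->.
  by rewrite mulmx0 !lincomb0.
- move=> [/= v0 /graphP[c vc]]; move: v0; rewrite vc /= => /basis_x.2 tc.
  by rewrite tc -[c]mul1mx -t't -mulmxA tc mulmx0 !lincomb0.
Qed.

(** An isometry that stabilizes X and Y is diag(a, d) with d^J a = 1.  It sends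
    the graph (t; 1) to (a t; d), which spans the graph of s iff a t = s d, that
    is s = a t d^-1 = d^-J t d^-1. *)
Lemma standard_triple_orbit t s :
  (exists2 k : {linear M -> M}, isometries h k
    & triple_act k (standard_triple t) = standard_triple s) <-> herm_orbit J t s.
Proof.
rewrite /standard_triple /triple_act !u_mx_image.
rewrite (first_summand_span y basis_x) (second_summand_span basis_x dual_xy) /=.
split=> [[k ik []]|[a [p [c [[ap pa] [ac ca] ->]]]]].
  have [K kK] := exists_mx_represents basis_b k.
  have [a [e [f [d KE]]]] : exists a e f d, K = block_mx a e f d.
    by exists (ulsubmx K), (ursubmx K), (dlsubmx K), (drsubmx K); rewrite submxK.
  subst K; have KSK := isometries_isometry_mx ik kK.
  rewrite !(image_mx_span _ kK) !mul_block_col !mulmx0 !mulmx1 !addr0 !add0r => KX KY KG.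
  have f0 : f = 0.
    have [|P] := mx_span_subset basis_b (A := col_mx a f) (B := col_mx 1%:M 0).
      by rewrite KX.
    by rewrite mul_col_mx mul0mx => /eq_col_mx[].
  have e0 : e = 0.
    have [|P] := mx_span_subset basis_b (A := col_mx e d) (B := col_mx 0 1%:M).
      by rewrite KY.
    by rewrite mul_col_mx mul0mx => /eq_col_mx[].
  have ats : a *m t = s *m d.
    have [|P] := mx_span_subset basis_b (A := col_mx (a *m t + e) (f *m t + d))
      (B := col_mx s 1%:M); first by rewrite KG.
    by rewrite mul_col_mx mul1mx e0 f0 mul0mx add0r addr0 => /eq_col_mx[-> ->].
  have da : d^J *m a = 1%:M.
    move: KSK; rewrite /isometry_mx mxJ_block_mx e0 f0 !mxJ0 !mulmx_block.
    by rewrite !mul0mx !mulmx0 !addr0 !add0r mulmx1 => /eq_block_mx[].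
  have [ad _] := left_inverse_mx_inverse hD da.
  have daJ : d *m a^J = 1%:M by rewrite -[d](mxJK J) -mxJ_mul ad mxJ1.
  have aJd : a^J *m d = 1%:M by rewrite -[d](mxJK J) -mxJ_mul da mxJ1.
  exists d, a^J, a; split; [by []|by []|].
  by rewrite ats -mulmxA daJ mulmx1.
(* Conversely, for s = c t p with p = a^-1 and c = a^-J, take diag(c, a). *)
have pc : p = c^J.
  have cp : c^J *m a = 1%:M by rewrite -[a](mxJK J) -mxJ_mul ac mxJ1.
  by rewrite -[p]mul1mx -cp -mulmxA ap mulmx1.
have [|k ik kK] := @isometry_mx_isometries (block_mx c 0 0 a).
  rewrite /isometry_mx mxJ_block_mx !mxJ0 !mulmx_block.
  rewrite !mul0mx !mulmx0 !addr0 !add0r !mulmx1 !mul0mx mulmxN mulNmx -(eps_mxC heps).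
  by rewrite -mulmxA -pc pa mulmx1 ac.
exists k => //; rewrite !(image_mx_span _ kK) !mul_block_col.
rewrite !mul0mx !mulmx0 !mulmx1 !addr0 !add0r.
have -> : col_mx c 0 = col_mx 1%:M 0 *m c :> 'M_(n + n, n).
  by rewrite mul_col_mx mul1mx mul0mx.
have -> : col_mx 0 a = col_mx 0 1%:M *m a :> 'M_(n + n, n).
  by rewrite mul_col_mx mul1mx mul0mx.
have -> : col_mx (c *m t) a = col_mx (c *m t *m p) 1%:M *m a.
  by rewrite mul_col_mx mul1mx -mulmxA pa mulmx1.
rewrite (mx_span_inverse _ _ (conj ca ac : mx_inverse c a^J)).
by rewrite !(mx_span_inverse _ _ (conj ap pa : mx_inverse a p)).
Qed.

Lemma triples_standard T : triples h T ->
  exists (g : {linear M -> M}) t, [/\ isometries h g, herm_mx J eps t,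
    nonsingular t & T = triple_act g (standard_triple t)].
Proof.
case: T => [[L1 L2] L3] [/= [lag1 lag2 lag3] [op12 op13 op23]].
have [g ig [L1E L2E]] := opposite_lagrangians_standard lag1 lag2 op12.
have [k ik [gK kK]] := isometries_inverse ig.
have kg L : k @` (g @` L) = L.
  by rewrite image_comp (_ : k \o g = id) ?image_id //; exact/funext.
have [||||t [tH tN L3E]] := @opposite_standard_graph (k @` L3).
- exact: first_summand_lagrangian.
- exact: isometry_lagrangian.
- by rewrite -[X0]kg -L1E; apply: isometry_opposite ik op13.
- by rewrite -[Y0]kg -L2E; apply: isometry_opposite ik op23.
exists g, t; split=> //; rewrite /triple_act /= -L1E -L2E -L3E image_comp.
by rewrite (_ : g \o k = id) ?image_id //; exact/funext.
Qed.

End HyperbolicLagrangians.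

Theorem theorem2p8 (D : unitRingType) (hD : GRing.field_axiom D)
    (J : involution D) (eps : D) (heps : eps = 1 \/ eps = -1)
    (n : nat) (X : lmodType D^c) (x : 'I_n -> X) (hx : is_basis x)
    (y : 'I_n -> dual X J) (hxy : forall i j, y i (x j) = (i == j)%:R) :
  let M := hyp_module X J in
  let h : M -> M -> D := hyp_form (- eps) in
  let X0 := [set v : M | v.2 = 0] in
  let Y0 := [set v : M | v.1 = 0] in
  let u (t : 'M[D]_n) := mx_end (hyp_basis x y) (u_mx t) in
  let L3 := triples h in
  exists kappa : set M * set M * set M -> set 'M[D]_n,
    [/\ set_fun L3 (Herm J eps n) kappa,
        forall g T, isometries h g -> L3 T -> kappa (triple_act g T) = kappa T,
        set_surj L3 (Herm J eps n) kappa,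
        forall T, L3 T ->
          L3 `&` kappa @^-1` [set kappa T] = triple_orbit h T &
        (forall g t, isometries h g -> herm_mx J eps t -> nonsingular t ->
           let T := (g @` X0, g @` Y0, g @` (u t @` Y0)) in
           L3 T /\ kappa T = herm_orbit J t) /\
        (forall T, L3 T ->
           exists g t, [/\ isometries h g, herm_mx J eps t, nonsingular t &
             T = (g @` X0, g @` Y0, g @` (u t @` Y0))])].
Proof.
move=> M h X0 Y0 u L3.
pose std := standard_triple x y.
pose kappa T : set 'M[D]_n :=
  [set s | exists2 g : {linear M -> M}, isometries h g & T = triple_act g (std s)].
have kappaE (g : {linear M -> M}) t :
    isometries h g -> kappa (triple_act g (std t)) = herm_orbit J t.
  move=> ig; apply/seteqP; split=> s.
    move=> [k ik e]; have [k' ik' [kK k'K]] := isometries_inverse ik.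
    apply/(standard_triple_orbit hD heps hx hxy); exists (k' \o g).
      exact: isometries_comp.
    by rewrite (triple_act_comp k' g) e triple_act_cancel.
  move=> /(standard_triple_orbit hD heps hx hxy)[k ik kts].
  have [k' ik' [kK k'K]] := isometries_inverse ik.
  exists (g \o k'); first exact: isometries_comp.
  by rewrite (triple_act_comp g k') /std -kts (triple_act_cancel _ kK).
have stdP T : L3 T -> exists (g : {linear M -> M}) t, [/\ isometries h g,
    herm_mx J eps t, nonsingular t & T = triple_act g (std t)].
  exact: triples_standard.
have kappa_act g T : isometries h g -> L3 T -> kappa (triple_act g T) = kappa T.
  move=> ig /stdP[k [t [ik _ _ ->]]].
  by rewrite -(triple_act_comp g k) !kappaE //; exact: isometries_comp.
exists kappa; split=> //.
- by move=> T /stdP[g [t [ig tH tN ->]]]; rewrite kappaE //; exists t.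
- move=> _ [t [tH tN] <-]; exists (std t).
    exact: standard_triple_triples.
  rewrite -(kappaE idfun t); last exact: isometries_id.
  by rewrite /triple_act !image_id.
- move=> T LT; apply/seteqP; split=> [T' [/stdP[g [t [ig tH tN T'E]]] /= e]|_ [g ig <-]].
    have : kappa T t by rewrite -e; exists g.
    move=> [k ik TE]; have [k' ik' [kK k'K]] := isometries_inverse ik.
    exists (g \o k'); first exact: isometries_comp.
    by rewrite TE (triple_act_comp g k') (triple_act_cancel _ kK).
  by split; [exact: isometry_triples|exact: kappa_act].
split=> [g t ig tH tN T|T /stdP[g [t [ig tH tN ->]]]]; last by exists g, t.
split; last exact: kappaE.
exact: (isometry_triples ig (standard_triple_triples hD heps hx hxy tH tN)).
Qed.
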